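(* Let $(X,d,W)$ be a complete $UCW$-hyperbolic space. Every nonempty closed convex subset $C$ of $X$ is a Chebyshev set; that is, for each $x\in X$ there exists a unique point $z\in C$ such that $d(x,z)=d(x,C)$, where $d(x,C)=\inf\{d(x,y)\mid y\in C\}$.
   Context: A $W$-hyperbolic space $(X,d,W)$ is a metric space $(X,d)$ with a map $W:X\times X\times[0,1]\to X$ such that for all $x,y,z,w\in X$, $\lambda,\tilde\lambda\in[0,1]$: (W1) $d(z,W(x,y,\lambda))\le(1-\lambda)d(z,x)+\lambda d(z,y)$; (W2) $d(W(x,y,\lambda),W(x,y,\tilde\lambda))=|\lambda-\tilde\lambda|\,d(x,y)$; (W3) $W(x,y,\lambda)=W(y,x,1-\lambda)$; (W4) $d(W(x,z,\lambda),W(y,w,\lambda))\le(1-\lambda)d(x,y)+\lambda d(z,w)$. Write $(1-\lambda)x\oplus\lambda y:=W(x,y,\lambda)$. A nonempty $C\subseteq X$ is convex if $(1-\lambda)x\oplus\lambda y\in C$ for all $x,y\in C$, $\lambda\in[0,1]$. $(X,d,W)$ is uniformly convex with modulus of uniform convexity $\eta:(0,\infty)\times(0,2]\to(0,1]$ if for all $r>0$, $\varepsilon\in(0,2]$, $a,x,y\in X$: $d(x,a)\le r$, $d(y,a)\le r$, $d(x,y)\ge\varepsilon r$ imply $d(\frac12x\oplus\frac12y,a)\le(1-\eta(r,\varepsilon))r$. The modulus $\eta$ is monotone if it decreases with $r$ for fixed $\varepsilon$ (i.e. $\eta(s,\varepsilon)\le\eta(r,\varepsilon)$ whenever $s\ge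 r$). A $UCW$-hyperbolic space is a uniformly convex $W$-hyperbolic space admitting a monotone modulus of uniform convexity. *)

(* Defs.v *)
From HB Require Import structures.
From mathcomp Require Import all_boot all_order all_algebra.
From mathcomp Require Import all_classical all_reals all_analysis.

Set Implicit Arguments.
Unset Strict Implicit.
Unset Printing Implicit Defensive.

Import Order.TTheory GRing.Theory Num.Theory.

Local Open Scope classical_set_scope.
Local Open Scope ring_scope.

(* The library's complete spaces carry a distinguished point; this only
   excludes the empty space. *)
#[short(type="completeMetricType")]
HB.structure Definition CompleteMetric (K : numDomainType) :=
  { M of Metric K M & Complete M }.

Section WHyperbolic.
Context {R : realType} {X : metricType R}.

(* A convexity mapping X * X * [0, 1] -> X is encoded by a function that is
   total in its real argument; its values outside [0, 1] are unconstrained.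
   [W x y l] is the point (1 - l) x (+) l y. *)
Implicit Types (W : X -> X -> R -> X) (eta : R -> R -> R) (C : set X).

Record W_hyperbolic W : Prop := {
  W_hyperbolic1 : forall x y z l, l \in `[0, 1] ->
    mdist z (W x y l) <= (1 - l) * mdist z x + l * mdist z y ;
  W_hyperbolic2 : forall x y l m, l \in `[0, 1] -> m \in `[0, 1] ->
    mdist (W x y l) (W x y m) = `|l - m| * mdist x y ;
  W_hyperbolic3 : forall x y l, l \in `[0, 1] ->
    W x y l = W y x (1 - l) ;
  W_hyperbolic4 : forall x y z w l, l \in `[0, 1] ->
    mdist (W x z l) (W y w l) <= (1 - l) * mdist x y + l * mdist z w
}.

Definition W_convex W C : Prop :=
  forall x y l, C x -> C y -> l \in `[0, 1] -> C (W x y l).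

(* A modulus is a function (0, +oo) * (0, 2] -> (0, 1]; as for W, its values
   outside this domain are unconstrained. *)
Record convexity_modulus W eta : Prop := {
  convexity_modulus_range : forall r e, 0 < r -> e \in `]0, 2] ->
    eta r e \in `]0, 1] ;
  convexity_modulusP : forall r e a x y, 0 < r -> e \in `]0, 2] ->
    mdist x a <= r -> mdist y a <= r -> e * r <= mdist x y ->
    mdist (W x y 2^-1) a <= (1 - eta r e) * r
}.

Definition monotone_modulus eta : Prop :=
  forall r s e, 0 < r -> r <= s -> e \in `]0, 2] -> eta s e <= eta r e.

Definition UCW_hyperbolic W : Prop :=
  W_hyperbolic W /\
  exists eta, convexity_modulus W eta /\ monotone_modulus eta.

Definition set_dist (x : X) C : R := inf [set mdist x y | y in C].

Definition Chebyshev_set C : Prop :=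
  forall x, exists! z, C z /\ mdist x z = set_dist x C.

End WHyperbolic.

(* Main.v *)
Require Import Defs.
From HB Require Import structures.
From mathcomp Require Import all_boot all_order all_algebra.
From mathcomp Require Import all_classical all_reals all_analysis.
From mathcomp Require Import lra.

(** Let D = d(x, C). If y, z in C are within r = D + delta of x and
    d(y, z) >= eps, uniform convexity puts the midpoint of y and z, which lies
    in C, within (1 - eta(r, e)) r of x, where e = min(2, eps / (D + 1)).
    Monotonicity bounds eta(r, e) below by eta(D + 1, e) uniformly in
    delta <= 1, so for small delta the midpoint would be closer to x than D (if
    D = 0, the triangle inequality suffices). Hence the sets of delta-almost
    nearest points of C have diameters tending to 0: they generate a Cauchy
    filter, whose limit is the nearest point, and the nearest point is unique. *)

Set Implicit Arguments.
Unset Strict Implicit.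
Unset Printing Implicit Defensive.

Import Order.TTheory GRing.Theory Num.Theory.

Local Open Scope classical_set_scope.
Local Open Scope ring_scope.

Section SetDist.
Context {R : realType} {X : metricType R}.
Implicit Types (x y : X) (C : set X).

Let dists_lbound x C : lbound [set mdist x y | y in C] 0.
Proof. by move=> _ [y _ <-]; exact: mdist_ge0. Qed.

Lemma set_dist_le x C y : C y -> set_dist x C <= mdist x y.
Proof.
by move=> Cy; apply: ge_inf; [exists 0; exact: dists_lbound | exists y].
Qed.

Lemma set_dist_ge0 x C : C !=set0 -> 0 <= set_dist x C.
Proof.
move=> [y Cy]; apply: lb_le_inf; last exact: dists_lbound.
by exists (mdist x y), y.
Qed.

Lemma set_dist_adherent x C e : C !=set0 -> 0 < e ->
  exists2 y, C y & mdist x y < set_dist x C + e.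
Proof.
move=> [y Cy] e0.
have [|_ [z Cz <-] zlt] := @inf_adherent _ [set mdist x y | y in C] _ e0.
  by split; [exists (mdist x y), y | exists 0; exact: dists_lbound].
by exists z.
Qed.

Definition almost_nearest x C (d : R) : set X :=
  [set y | C y /\ mdist x y <= set_dist x C + d].

(** The sets shrink with [d], and none is empty because the infimum is approached within [C]. *)
Lemma almost_nearest_filter x C : C !=set0 ->
  ProperFilter (filter_from [set d : R | 0 < d] (almost_nearest x C)).
Proof.
move=> C0; apply: filter_from_proper => [|d /= d0].
  apply: filter_from_filter; first by exists 1 => /=.
  move=> d e /= d0 e0; exists (Num.min d e); first by rewrite /= lt_min d0.
  move=> y [Cy yle]; split; split=> //; apply: (le_trans yle);
    by rewrite lerD2l ge_min lexx ?orbT.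
by have [y Cy /ltW yle] := set_dist_adherent x C0 d0; exists y.
Qed.

End SetDist.

Lemma UCW_almost_nearest_small (R : realType) (X : metricType R)
    (W : X -> X -> R -> X) (C : set X) (x : X) (eps : R) :
  UCW_hyperbolic W -> W_convex W C -> C !=set0 -> 0 < eps ->
  exists2 d : R, 0 < d & forall y z,
    almost_nearest x C d y -> almost_nearest x C d z -> mdist y z < eps.
Proof.
move=> [_ [eta [etaP eta_mono]]] Cconvex C0 eps0.
have := set_dist_ge0 x C0; rewrite le_eqVlt => /predU1P[D0|D0].
  exists (eps / 3) => [|y z [_ xy] [_ xz]]; first by rewrite divr_gt0.
  have := metric_triangle y x z; rewrite (metric_sym y x).
  by move: xy xz; rewrite -D0; lra.
set D := set_dist x C in D0 *.
(* The cap 2 keeps [e] in the domain of [eta]; since the radius is at most [D + 1], [e] times the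
   radius is at most [eps]. *)
pose e := Num.min 2 (eps / (D + 1)).
have e_itv : e \in `]0, 2].
  by rewrite in_itv /= lt_min ge_min lexx andbT ltr0n divr_gt0 ?addr_gt0.
have := convexity_modulus_range etaP (addr_gt0 D0 ltr01) e_itv.
rewrite in_itv /=; set h := eta _ _ => /andP[h0 h1].
(* The bound 1 keeps the radius [D + d] below [D + 1]; the bound [h * D / 2] forces
   [(1 - h) * (D + d) < D]. *)
exists (Num.min 1 (h * D / 2)) => [|y z [Cy xy] [Cz xz]].
  by rewrite lt_min ltr01 divr_gt0 ?mulr_gt0.
rewrite ltNge; apply/negP => yz.
set d := Num.min _ _ in xy xz.
have d0 : 0 < d by rewrite lt_min ltr01 divr_gt0 ?mulr_gt0.
have d1 : d <= 1 by rewrite ge_min lexx.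
have dh : d <= h * D / 2 by rewrite ge_min lexx orbT.
have r0 : 0 < D + d by rewrite addr_gt0.
have eyz : e * (D + d) <= mdist y z.
  apply: le_trans yz; apply: (@le_trans _ _ (eps / (D + 1) * (D + d))).
    by rewrite ler_pM2r // ge_min lexx orbT.
  by rewrite mulrAC ler_pdivrMr ?addr_gt0 // ler_pM2l // lerD2l.
have Cm : C (W y z 2^-1).
  by apply: Cconvex => //; rewrite in_itv /=; apply/andP; split; lra.
have := convexity_modulusP etaP r0 e_itv; move=> /(_ x y z).
rewrite (metric_sym y) (metric_sym z) => /(_ xy xz eyz).
have := set_dist_le x Cm; rewrite (metric_sym x) -/D => Dm mle.
have hle : h <= eta (D + d) e by apply: eta_mono; rewrite ?lerD2l.
have : D <= (1 - h) * (D + d).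
  by apply: (le_trans Dm); apply: (le_trans mle); rewrite ler_pM2r // lerB.
have := mulr_gt0 h0 D0; have := mulr_gt0 h0 d0.
by clear - dh; nra.
Qed.

Theorem proposition2p4 (R : realType) (X : completeMetricType R)
    (W : X -> X -> R -> X) (UCW : UCW_hyperbolic W)
    (C : set X) (C0 : C !=set0) (Cclosed : closed C) (Cconvex : W_convex W C) :
  Chebyshev_set C.
Proof.
move=> x.
have small eps := @UCW_almost_nearest_small R X W C x eps UCW Cconvex C0.
set F := filter_from [set d : R | 0 < d] (almost_nearest x C).
have FF : ProperFilter F := almost_nearest_filter x C0.
have /cauchy_cvg/cvg_ex[z Fz] : cauchy F.
  apply: cauchy_exP => eps /small[d d0 dP].
  have [y Cy /ltW yle] := set_dist_adherent x C0 d0.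
  exists y, d => // t Ft; rewrite ballEmdist /=.
  exact: dP.
(* As [F] converges to [z], each ball around [z] belongs to [F] and so meets every almost-nearest
   set. *)
have near_z e : 0 < e -> exists2 y, almost_nearest x C e y & mdist z y < e.
  move=> e0; have Fe : F (almost_nearest x C e) by exists e.
  have [y [Fy]] := filter_ex (filterI Fe (Fz _ (nbhsx_ballx z e e0))).
  by rewrite ballEmdist; exists y.
have Cz : C z.
  apply: Cclosed => B; rewrite -nbhs_ballE => -[e e0 zB].
  have [y [Cy _] zy] := near_z e e0.
  by exists y; split=> //; apply: zB; rewrite ballEmdist.
have xz : mdist x z = set_dist x C.
  apply/eqP; rewrite eq_le set_dist_le // andbT.
  apply/ler_addgt0Pr => e e0.
  (* One half of [e] pays for the excess of [mdist x y], the other for the move from [y] to [z]. *)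
  have [y [_ xy] zy] := near_z _ (divr_gt0 e0 (ltr0n R 2)).
  have := metric_triangle x y z; rewrite (metric_sym y).
  by move: xy zy; lra.
exists z; split=> // y [Cy xy].
(* Uniqueness: smallness with [eps] equal to [mdist z y] itself would give
   [mdist z y < mdist z y]. *)
apply/eqP/negPn; rewrite -mdist_gt0; apply/negP => zy.
have [d d0 /(_ z y)] := small _ zy.
rewrite ltxx => abs; apply: notF; apply: abs; split=> //.
  by rewrite xz lerDl ltW.
by rewrite xy lerDl ltW.
Qed.
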